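(* Let $r\in\mathbb N$ and $n\in\mathbb N_0$. Let $\mathcal P_e(n,2r)$ (resp. $\mathcal P_o(n,2r)$) be the set of partitions of $n$ in which the number of parts divisible by $2r$ (with multiplicity) is even (resp. odd), and let $\mathcal Q_o(n,r)$ be the set of partitions of $n$ with no part divisible by $2r$ and whose parts divisible by $r$ are distinct. Then \[ \sum_{\lambda\in\mathcal P_e(n,2r)}\ell(\lambda)-\sum_{\lambda\in\mathcal P_o(n,2r)}\ell(\lambda)-\sum_{\lambda\in\mathcal Q_o(n,r)}\ell(\lambda) \] equals the number of pairs $(\lambda,(a^b))$ with $a,b$ positive integers such that (i) $2r\mid a$, and (ii) $\lambda\in\mathcal Q_o(n-ab,r)$.
   Context: A partition is a non-increasing sequence of positive integers; the empty partition (of $0$) is allowed for $\lambda$. $(a^b)$ denotes the partition with $b$ parts equal to $a$. $\ell(\lambda)$ denotes the number of parts of $\lambda$ counted with multiplicity. *)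

(* Defs.v *)
From HB Require Import structures.
From mathcomp Require Import all_boot all_order all_algebra.

Set Implicit Arguments.
Unset Strict Implicit.
Unset Printing Implicit Defensive.

Definition is_intpart (n : nat) (s : seq nat) : bool :=
  [&& sorted geq s, all (ltn 0) s & sumn s == n].

Record intpart (n : nat) : Type :=
  IntPart { parts :> seq nat; _ : is_intpart n parts }.

HB.instance Definition _ n := [isSub for @parts n].
HB.instance Definition _ n := [Countable of intpart n by <:].

(* Finiteness: a partition of n has at most n parts, each at most n. *)
Definition intpart_bseq n (l : intpart n) : {bseq n of 'I_n.+1} :=
  insub_bseq n [seq inord x | x <- parts l].
Definition bseq_intpart n (s : {bseq n of 'I_n.+1}) : option (intpart n) :=
  insub [seq val i | i <- s].

Lemma intpart_bseqK n : pcancel (@intpart_bseq n) (@bseq_intpart n).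
Proof.
case=> s sP; have /and3P[_ s_gt0 /eqP s_sum] := sP.
have s_size : size s <= n.
  rewrite -s_sum; elim: s s_gt0 {sP s_sum} => //= x s IHs /andP[x_gt0 s_gt0].
  by rewrite -add1n leq_add // IHs.
have s_le x : x \in s -> x <= n.
  rewrite -s_sum; elim: s {sP s_gt0 s_sum s_size} => //= y s IHs.
  rewrite inE => /orP[/eqP-> | /IHs sx]; first exact: leq_addr.
  exact: leq_trans sx (leq_addl _ _).
have sK : [seq val i | i <- intpart_bseq (IntPart sP)] = s.
  rewrite val_insubd size_map s_size -map_comp -[RHS]map_id.
  by apply/eq_in_map => x /s_le sx /=; rewrite inordK.
by rewrite /bseq_intpart sK -[s]/(val (IntPart sP)) valK.
Qed.

HB.instance Definition _ n : isFinite (intpart n) :=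
  PCanIsFinite (@intpart_bseqK n).

Definition ndivparts (m : nat) (s : seq nat) : nat := count (dvdn m) s.

Definition Pe (n m : nat) : {set intpart n} :=
  [set l : intpart n | ~~ odd (ndivparts m l)].

Definition Po (n m : nat) : {set intpart n} :=
  [set l : intpart n | odd (ndivparts m l)].

Definition Qo (n r : nat) : {set intpart n} :=
  [set l : intpart n | (ndivparts (2 * r) l == 0) && uniq [seq x <- l | r %| x]].

(* A pair (lambda, (a^b)) is encoded by (a, b) and lambda : intpart (n - a * b);
   (a, b) |-> (a^b) is injective on positive a, b.  The bounds a, b <= n lose
   nothing since a, b >= 1 and a * b <= n.  As n - a * b is truncated, a * b <= n
   has to be required explicitly. *)
Definition rect_pair (n : nat) : Type :=
  {ab : 'I_n.+1 * 'I_n.+1 & intpart (n - ab.1 * ab.2)}.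

HB.instance Definition _ n := Finite.on (rect_pair n).

Definition Rpairs (n r : nat) : {set rect_pair n} :=
  [set p : rect_pair n | let: existT (a, b) l := p in
     [&& 0 < a, 0 < b, a * b <= n, 2 * r %| a & l \in Qo (n - a * b) r]].

(* Main.v *)
(* Write f(n) for the sum over the partitions of n of (-1)^(number of parts
   divisible by 2r), and q(n) for the size of Q_o(n, r).  Deleting one copy of a
   given part a from the partitions that contain it shows that each of these
   weights satisfies, for every function c on parts,
     sum_lambda W(lambda) sum_(x in lambda) c(x)
       = sum_(a, b >= 1) c(a) e(a) t(a)^(b-1) F(n - ab),
   where e = t = (-1)^[2r | a] for f, and e(a) = [2r does not divide a],
   t(a) = (-1)^[r | a] for q.  The two kernels differ by
   2 [r | a and 2 | b] - [2r | a], and (a, b) |-> (2a, b/2) matches the pairs of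
   the first kind with those of the second, keeping ab fixed.  For c(x) = x the
   kernels therefore have the same sum over ab = N, so n f(n) and n q(n) obey the
   same recursion and f = q; for c = 1 the difference of the sums is the number of
   divisors of N that are multiples of 2r. *)
Require Import Defs.
From mathcomp Require Import all_boot all_order all_algebra.
From mathcomp Require Import zify ring.
Import GRing.Theory Num.Theory.
Local Open Scope ring_scope.

(** * Inserting a part into a partition and removing it *)

Lemma geq_total : total geq.
Proof. by move=> x y; exact: leq_total. Qed.

Lemma geq_trans : transitive geq.
Proof. by move=> y x z /= yx zy; exact: leq_trans zy yx. Qed.

Lemma geq_anti : antisymmetric geq.
Proof. by move=> x y; rewrite /= andbC => /anti_leq. Qed.

Lemma mem_intpart n (l : intpart n) x : x \in parts l -> (0 < x <= n)%N.
Proof.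
have /and3P[_ /allP l_gt0 /eqP l_sum] := valP l.
move=> x_l; apply/andP; split; first exact: l_gt0.
by rewrite -l_sum (perm_sumn (perm_to_rem x_l)) leq_addr.
Qed.

Lemma is_intpart_insert {n a s} :
  (0 < a)%N -> is_intpart n s -> is_intpart (n + a) (sort geq (a :: s)).
Proof.
move=> a_gt0 /and3P[_ s_gt0 /eqP s_sum]; apply/and3P; split.
- exact: (sort_sorted geq_total).
- by rewrite all_sort /= a_gt0.
- by rewrite (perm_sumn (permEl (perm_sort _ _))) /= s_sum addnC.
Qed.

Definition insert_part n a (a_gt0 : (0 < a)%N) (l : intpart n) :
  intpart (n + a) := IntPart (is_intpart_insert a_gt0 (valP l)).

Lemma insert_part_inj n a (a_gt0 : (0 < a)%N) :
  injective (@insert_part n a a_gt0).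
Proof.
move=> l l' /(congr1 (@parts _)) /= eq_s; apply: val_inj => /=.
have /and3P[l_sorted _ _] := valP l; have /and3P[l'_sorted _ _] := valP l'.
apply: (sorted_eq geq_trans geq_anti l_sorted l'_sorted).
by rewrite -(perm_cons a) -(perm_sort geq) eq_s perm_sort.
Qed.

Lemma mem_codom_insert_part n a (a_gt0 : (0 < a)%N) (l : intpart (n + a)) :
  (l \in codom (@insert_part n a a_gt0)) = (a \in parts l).
Proof.
apply/codomP/idP => [[l' ->] | a_l] /=.
  by rewrite mem_sort mem_head.
have /and3P[l_sorted l_gt0 /eqP l_sum] := valP l.
have perm_l := perm_to_rem a_l.
have l'P : is_intpart n (rem a (parts l)).
  apply/and3P; split.
  - exact: (subseq_sorted geq_trans (rem_subseq _ _)).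
  - by apply/allP => x /mem_rem; apply/allP.
  - by move: l_sum; rewrite (perm_sumn perm_l) /= addnC => /addIn ->.
exists (IntPart l'P); apply: val_inj => /=.
apply: (sorted_eq geq_trans geq_anti l_sorted).
  exact: (sort_sorted geq_total).
by rewrite perm_sym perm_sort perm_sym.
Qed.

(** Insertion of [a] is a bijection from the partitions of [n] onto the partitions of [n + a] that
    contain [a]. Since insertion sorts, [G] has to ignore the order of the parts. *)
Lemma sum_intpart_mem (G : seq nat -> int) n a :
  (0 < a)%N -> (forall s s', perm_eq s s' -> G s = G s') ->
  \sum_(l : intpart (n + a) | a \in parts l) G l
  = \sum_(l : intpart n) G (a :: l).
Proof.
move=> a_gt0 G_perm.
transitivity (\sum_(l in [set insert_part n a a_gt0 l | l : intpart n]) G l).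
  apply: eq_bigl => l; rewrite -(mem_codom_insert_part _ _ a_gt0).
  by apply/codomP/imsetP => [[x ->]|[x _ ->]]; exists x.
rewrite big_imset /=; last by move=> x y _ _; exact: insert_part_inj.
by apply: eq_big => [l | l _]; rewrite ?inE //; apply/G_perm/permEl/perm_sort.
Qed.

(** * Sums over divisors and over parts *)

(** The range of [a] on the left does not depend on [N], which allows sums over [a] and [N] to be
    exchanged. *)
Lemma sum_divisors (H : nat -> int) n N : (0 < N <= n)%N ->
  \sum_(1 <= a < n.+1 | (a %| N)%N) H a = \sum_(a <- divisors N) H a.
Proof.
move=> /andP[N_gt0 le_Nn]; rewrite -big_filter; apply: perm_big.
apply: uniq_perm; rewrite ?filter_uniq ?iota_uniq ?divisors_uniq // => a.
rewrite mem_filter mem_index_iota -dvdn_divisors //.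
case aN: (a %| N)%N => //=.
by have := dvdn_leq N_gt0 aN; have := dvdn_gt0 N_gt0 aN; lia.
Qed.

Lemma sum_count_mem (c : nat -> int) n s :
  (forall x, x \in s -> 0 < x <= n)%N ->
  \sum_(1 <= a < n.+1) c a * (count_mem a s)%:R = \sum_(x <- s) c x.
Proof.
elim: s => [|x s IHs] s_int.
  by rewrite big_nil big1 // => a _; rewrite mulr0.
rewrite big_cons -IHs => [|y ys]; last by apply: s_int; rewrite inE ys orbT.
under eq_bigr => a _ do rewrite /= natrD mulrDr.
rewrite big_split /=; congr (_ + _).
rewrite (bigD1_seq x) ?iota_uniq ?mem_index_iota ?ltnS ?s_int ?mem_head //=.
rewrite eqxx mulr1 big1 ?addr0 // => a /negPf neq_ax.
by rewrite eq_sym neq_ax mulr0.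
Qed.

(** * Part-deletion recursion for a general weight *)

Section PartitionSums.

Variable W : seq nat -> int.

Definition psum n : int := \sum_(l : intpart n) W l.

Definition psum_part a n : int := \sum_(l : intpart n) W l * (count_mem a l)%:R.

Variables e t : nat -> int.
Hypothesis W_perm : forall s s', perm_eq s s' -> W s = W s'.
Hypothesis W_cons : forall a s, (0 < a)%N ->
  W (a :: s) * (count_mem a s).+1%:R
  = e a * W s + t a * (W s * (count_mem a s)%:R).

(** Partitions of [n + a] without [a] contribute zero; the others arise by inserting [a] into a
    partition of [n], where [W_cons] applies. *)
Lemma psum_part_rec a n : (0 < a)%N ->
  psum_part a (n + a) = e a * psum n + t a * psum_part a n.
Proof.
move=> a_gt0; rewrite /psum_part (bigID (fun l : intpart _ => a \in parts l)) /=.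
rewrite [X in _ + X]big1 ?addr0; last first.
  by move=> l /count_memPn ->; rewrite mulr0.
rewrite (sum_intpart_mem (fun s => W s * (count_mem a s)%:R)) //; last first.
  by move=> s s' ss'; rewrite (W_perm _ _ ss') (permP ss').
rewrite /psum !mulr_sumr -big_split; apply: eq_bigr => l _ /=.
by rewrite eqxx add1n W_cons.
Qed.

Lemma psum_part_lt a n : (n < a)%N -> psum_part a n = 0.
Proof.
move=> lt_na; apply: big1 => l _; suff /count_memPn -> : a \notin parts l.
  by rewrite mulr0.
by apply/negP => /mem_intpart; lia.
Qed.

(** Unrolls [psum_part_rec] in steps of [a]. The index is N = ab, so that b is [N %/ a]. *)
Lemma psum_partE a n : (0 < a)%N ->
  psum_part a n
  = \sum_(1 <= N < n.+1 | (a %| N)%N) e a * t a ^+ (N %/ a).-1 * psum (n - N).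
Proof.
move=> a_gt0; have [m] := ubnP n; elim: m n => // m IHm n lt_nm.
have [lt_na | le_an] := ltnP n a.
  rewrite psum_part_lt // big_nat_cond big1 // => N /andP[/andP[N1 Nn] aN].
  by have := dvdn_leq N1 aN; lia.
rewrite -(subnK le_an) psum_part_rec // IHm; last by lia.
rewrite [RHS](@big_cat_nat _ _ _ a) //=; last by lia.
rewrite [X in _ = X + _]big_nat_cond [X in _ = X + _]big1 ?add0r; last first.
  by move=> N /andP[/andP[N1 Na] aN]; have := dvdn_leq N1 aN; lia.
rewrite -{1}[a in RHS]add0n [RHS]big_addn.
rewrite (_ : ((n - a + a).+1 - a = (n - a).+1)%N); last by lia.
(* After the shift by [a], index 0 carries the term N = a, which is the [e a] term of the
   recursion. *)
rewrite [RHS]big_mkcond [RHS]big_ltn // -big_mkcond /=.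
rewrite add0n dvdnn divnn a_gt0 mulr1 addnK.
congr (_ + _); rewrite mulr_sumr [LHS]big_nat_cond [RHS]big_nat_cond.
apply: eq_big => [N | N /andP[/andP[N1 Nn] aN]].
  by rewrite dvdn_addl.
rewrite subnDr divnDr // divnn a_gt0 addn1 /=.
(* A positive quotient keeps the predecessor from truncating, so exactly one more factor [t a] comes
   out. *)
have : (0 < N %/ a)%N by rewrite divn_gt0 // dvdn_leq.
by case: (N %/ a)%N => // k _; rewrite exprS; ring.
Qed.

(** Group the parts of each partition by value, apply [psum_partE] to each value, then collect the
    terms with the same product N = ab. *)
Lemma psum_weighted (c : nat -> int) n :
  \sum_(l : intpart n) W l * \sum_(x <- parts l) c x
  = \sum_(1 <= N < n.+1)
      psum (n - N) * \sum_(a <- divisors N) c a * (e a * t a ^+ (N %/ a).-1).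
Proof.
transitivity (\sum_(1 <= a < n.+1) c a * psum_part a n).
  under [RHS]eq_bigr do rewrite mulr_sumr.
  rewrite exchange_big /=; apply: eq_bigr => l _.
  under [RHS]eq_bigr do rewrite mulrCA.
  rewrite -mulr_sumr; congr (_ * _).
  by rewrite sum_count_mem // => x; exact: mem_intpart.
rewrite big_nat; under eq_bigr => a /andP[a_gt0 _].
  rewrite psum_partE // big_mkcond mulr_sumr; over.
rewrite -big_nat exchange_big /= [LHS]big_nat [RHS]big_nat; apply: eq_bigr => N N_int.
rewrite -(sum_divisors _ n) // mulr_sumr [RHS]big_mkcond; apply: eq_bigr => a _.
by case: ifP => _; rewrite ?mulr0 //; ring.
Qed.

End PartitionSums.

(** * The two weights and their kernels *)

Definition Pweight (r : nat) (s : seq nat) : int := (-1) ^+ ndivparts (2 * r) s.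

Definition Qweight (r : nat) (s : seq nat) : int :=
  ((ndivparts (2 * r) s == 0%N) && uniq [seq x <- s | (r %| x)%N])%:R.

Lemma Pweight_perm r s s' : perm_eq s s' -> Pweight r s = Pweight r s'.
Proof. by move=> /permP ss'; rewrite /Pweight /ndivparts ss'. Qed.

Lemma Qweight_perm r s s' : perm_eq s s' -> Qweight r s = Qweight r s'.
Proof.
move=> ss'; rewrite /Qweight /ndivparts (permP ss').
by rewrite (perm_uniq (perm_filter _ ss')).
Qed.

Definition Psign (r a : nat) : int := (-1) ^+ (2 * r %| a)%N.

Lemma Pweight_cons r a s : (0 < a)%N ->
  Pweight r (a :: s) * (count_mem a s).+1%:R
  = Psign r a * Pweight r s + Psign r a * (Pweight r s * (count_mem a s)%:R).
Proof.
by move=> _; rewrite /Pweight /Psign /ndivparts /= exprD -natr1; ring.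
Qed.

Definition Qcoef (r a : nat) : int := (~~ (2 * r %| a)%N)%:R.

Definition Qsign (r a : nat) : int := (-1) ^+ (r %| a)%N.

Lemma Qweight_cons r a s : (0 < a)%N ->
  Qweight r (a :: s) * (count_mem a s).+1%:R
  = Qcoef r a * Qweight r s + Qsign r a * (Qweight r s * (count_mem a s)%:R).
Proof.
move=> _; rewrite /Qweight /Qcoef /Qsign /ndivparts /=.
have [r2_a | r2N_a] := boolP (2 * r %| a)%N.
  rewrite /= !mul0r add0r.
  (* If [a] occurs in [s], then [s] already has a part divisible by 2r and its weight is 0. *)
  have [a_s | /count_memPn ->] := boolP (a \in s); last by rewrite !mulr0.
  suff -> : (count (dvdn (2 * r)) s == 0%N) = false by rewrite !mul0r mulr0.
  by apply/negbTE; rewrite -lt0n -has_count; apply/hasP; exists a.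
rewrite add0n; have [r_a | rN_a] /= := boolP (r %| a)%N; last first.
  by rewrite -natr1; ring.
rewrite mem_filter r_a /=.
have [a_s | a_s] := boolP (a \in s); last first.
  by rewrite (count_memPn a_s) /=; ring.
rewrite andbF; have [/= us|_] := boolP (uniq _); last by rewrite andbF /=; ring.
(* A second copy of [a] makes the left side 0; distinctness forces multiplicity 1 in [s], so the
   right side is 1 - 1. *)
have -> : count_mem a s = 1%N.
  have := count_uniq_mem a us; rewrite mem_filter r_a a_s /= => <-.
  rewrite count_filter; apply: eq_count => x /=.
  by case: eqP => // ->; rewrite r_a.
by ring.
Qed.

(** If 2r divides a, both sides are (-1)^b; if only r does, both are 1 + (-1)^b; otherwise both
    vanish. *)
Lemma kernel_diff r a b : (0 < b)%N ->
  Psign r a * Psign r a ^+ b.-1 - Qcoef r a * Qsign r a ^+ b.-1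
  = 2 * ((r %| a) && (2 %| b))%N%:R - (2 * r %| a)%N%:R.
Proof.
case: b => // b _ /=; rewrite /Psign /Qcoef /Qsign dvdn2 /= negbK.
have [r2_a | _] := boolP (2 * r %| a)%N.
  rewrite (dvdn_trans (dvdn_mull 2 (dvdnn r)) r2_a) /=.
  by rewrite !expr1 -(signr_odd _ b); case: (odd b) => /=; ring.
have [_ | _] := boolP (r %| a)%N; rewrite /= !expr0 ?expr1 !expr1n; last by ring.
by rewrite -(signr_odd _ b); case: (odd b) => /=; ring.
Qed.

Lemma sum_divisors_double (g : nat -> int) r N : (0 < N)%N ->
  \sum_(a <- divisors N) ((r %| a) && (2 %| N %/ a))%N%:R * g (2 * a)%N
  = \sum_(a <- divisors N) (2 * r %| a)%N%:R * g a.
Proof.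
move=> N_gt0; under eq_bigr do rewrite mulr_natl mulrb.
under [RHS]eq_bigr do rewrite mulr_natl mulrb.
rewrite -!big_mkcond -big_filter -[RHS]big_filter.
rewrite -(big_map (muln 2) xpredT g); apply: perm_big; apply: uniq_perm.
- by rewrite map_inj_uniq ?filter_uniq ?divisors_uniq // => x y; lia.
- by rewrite filter_uniq ?divisors_uniq.
move=> d; rewrite mem_filter -dvdn_divisors //; apply/mapP/andP.
  move=> [a]; rewrite mem_filter -dvdn_divisors // => /andP[/andP[r_a b_even] a_N].
  move=> ->; rewrite dvdn_pmul2l //; split=> //.
  by rewrite -(divnK a_N) dvdn_pmul2r // (dvdn_gt0 N_gt0).
(* A divisor d = 2kr of N is the double of kr, whose cofactor in N is even. *)
move=> [/dvdnP[k ->]]; rewrite mulnCA => kr_N; exists (k * r)%N => //.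
have kr_N' := dvdn_trans (dvdn_mull 2 (dvdnn _)) kr_N.
rewrite mem_filter -dvdn_divisors // kr_N' dvdn_mull //= andbT.
by rewrite -(@dvdn_pmul2r (k * r)) ?divnK // (dvdn_gt0 N_gt0).
Qed.

(** [kernel_diff] summed over ab = N. The function [c] stays general because both c(x) = x and c = 1
    are needed. *)
Lemma Pkernel_sum (c : nat -> int) r N : (0 < N)%N ->
  \sum_(a <- divisors N) c a * (Psign r a * Psign r a ^+ (N %/ a).-1)
  = \sum_(a <- divisors N) c a * (Qcoef r a * Qsign r a ^+ (N %/ a).-1)
    + (\sum_(a <- divisors N) ((r %| a) && (2 %| N %/ a))%N%:R * (2 * c a)
       - \sum_(a <- divisors N) (2 * r %| a)%N%:R * c a).
Proof.
move=> N_gt0; rewrite -sumrB -big_split /=; apply: eq_big_seq => a.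
rewrite -dvdn_divisors // => a_N.
have b_gt0 : (0 < N %/ a)%N by rewrite divn_gt0 ?(dvdn_gt0 N_gt0) // dvdn_leq.
by have /eqP := kernel_diff r a _ b_gt0; rewrite subr_eq => /eqP ->; ring.
Qed.

(** * Equality of the two weighted counts *)

Lemma psum_Pweight r n : psum (Pweight r) n = psum (Qweight r) n.
Proof.
have [m] := ubnP n; elim: m n => // m IHm [_ | n lt_nm].
  apply: eq_bigr => l _; have -> : parts l = [::].
    case E: (parts l) => [//|x s].
    by have := @mem_intpart _ l x; rewrite E mem_head => /(_ isT); lia.
  by rewrite /Pweight /Qweight /= expr0.
have sum_parts (W : seq nat -> int) :
    \sum_(l : intpart n.+1) W l * \sum_(x <- parts l) x%:R
    = n.+1%:R * psum W n.+1 :> int.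
  rewrite /psum mulr_sumr; apply: eq_bigr => l _; rewrite mulrC.
  have /and3P[_ _ /eqP l_sum] := valP l; congr (_ * _).
  by rewrite -natr_sum -sumnE l_sum.
(* The recursion with c(x) = x only determines the count times its size, hence the separate case of
   size 0. *)
apply: (@mulfI _ n.+1%:R); first by rewrite pnatr_eq0.
rewrite -!sum_parts.
rewrite (psum_weighted _ _ _ (Pweight_perm r) (Pweight_cons r)).
rewrite (psum_weighted _ _ _ (Qweight_perm r) (Qweight_cons r)).
rewrite [LHS]big_nat [RHS]big_nat; apply: eq_bigr => N /andP[N_gt0 le_Nn].
rewrite IHm; last by lia.
(* For c(x) = x, 2c(a) = c(2a), so doubling makes the two correction sums cancel. *)
rewrite Pkernel_sum // -(sum_divisors_double _ r) //.
under [X in _ + (_ - X)]eq_bigr do rewrite natrM.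
by rewrite subrr addr0.
Qed.

(** * Counting the pairs *)

Lemma sum_multiples (H : nat -> int) n a : (0 < a)%N ->
  \sum_(1 <= b < n.+1 | (a * b <= n)%N) H (a * b)%N
  = \sum_(1 <= N < n.+1 | (a %| N)%N) H N.
Proof.
move=> a_gt0; rewrite -big_filter -[RHS]big_filter.
rewrite -(big_map (muln a) xpredT H); apply: perm_big; apply: uniq_perm.
- rewrite map_inj_uniq ?filter_uniq ?iota_uniq // => x y /eqP.
  by rewrite eqn_pmul2l // => /eqP.
- by rewrite filter_uniq ?iota_uniq.
move=> N; rewrite mem_filter mem_index_iota; apply/mapP/andP.
  move=> [b]; rewrite mem_filter mem_index_iota => /and3P[ab_n b_gt0 _] ->.
  by rewrite dvdn_mulr // muln_gt0 a_gt0 b_gt0.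
move=> [/dvdnP[b ->] /andP[]]; rewrite muln_gt0 mulnC => /andP[b_gt0 _] ab_n.
exists b => //; rewrite mem_filter mem_index_iota b_gt0 ltnS -ltnS ab_n /=.
by apply: leq_ltn_trans ab_n; rewrite leq_pmull.
Qed.

Lemma card_Rpairs r n :
  #|Rpairs n r|%:R = \sum_(1 <= N < n.+1) psum (Qweight r) (n - N)
                       * \sum_(a <- divisors N) (2 * r %| a)%N%:R :> int.
Proof.
transitivity (\sum_(1 <= a < n.+1) (2 * r %| a)%N%:R *
  \sum_(1 <= b < n.+1 | (a * b <= n)%N) psum (Qweight r) (n - a * b)).
  (* [f] vanishes at a = 0 and at b = 0, so the pairs are summed over the full square of indices
     first and those terms dropped afterwards. *)
  pose f a b : int := [&& 0 < a, 0 < b, a * b <= n & 2 * r %| a]%N%:R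
                      * psum (Qweight r) (n - a * b).
  transitivity (\sum_(a < n.+1) \sum_(b < n.+1) f a b).
    rewrite pair_bigA -sum1_card natr_sum big_mkcond /=.
    under [RHS]eq_bigr do rewrite /f /psum mulr_sumr.
    (* The double sum over (a, b) and over partitions of n - ab becomes one sum over the dependent
       pairs. *)
    rewrite sig_big_dep; apply: eq_bigr => -[[a b] l] _ /=.
    by rewrite !inE /Qweight -mulrb -natrM mulnb -!andbA.
  under eq_bigr => a _.
    rewrite -(big_mkord xpredT (f a)) big_ltn // {1}/f /= andbF mul0r add0r; over.
  rewrite -(big_mkord xpredT (fun a => \sum_(1 <= b < n.+1) f a b)) big_ltn //.
  rewrite [X in X + _]big1 ?add0r; last by move=> b _; rewrite /f mul0r.
  rewrite [LHS]big_nat [RHS]big_nat; apply: eq_bigr => a /andP[a_gt0 _].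
  rewrite mulr_sumr [RHS]big_mkcond [LHS]big_nat [RHS]big_nat.
  apply: eq_bigr => b /andP[b_gt0 _]; rewrite /f a_gt0 b_gt0 /=.
  by case: ifP => _; rewrite ?mul0r.
rewrite big_nat; under eq_bigr => a /andP[a_gt0 _].
  rewrite (sum_multiples (fun N => psum _ (n - N))) // big_mkcond mulr_sumr; over.
rewrite -big_nat exchange_big /= [LHS]big_nat [RHS]big_nat; apply: eq_bigr => N N_int.
rewrite -(sum_divisors _ n) // mulr_sumr [RHS]big_mkcond; apply: eq_bigr => a _.
by case: ifP => _; rewrite ?mulr0 // mulrC.
Qed.

(** * Comparison of the numbers of parts *)

Theorem theorem1p5 (r n : nat) (r_gt0 : (0 < r)%N) :
  (\sum_(l in Pe n (2 * r)) size l)%N%:Z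
  - (\sum_(l in Po n (2 * r)) size l)%N%:Z
  - (\sum_(l in Qo n r) size l)%N%:Z
  = #|Rpairs n r|%:Z.
Proof.
have sizeE (s : seq nat) : \sum_(x <- s) 1 = (size s)%:R :> int.
  by rewrite big_const_seq count_predT iter_addr_0.
rewrite -!natz !natr_sum.
have -> : \sum_(l in Pe n (2 * r)) (size l)%:R
          - \sum_(l in Po n (2 * r)) (size l)%:R
        = \sum_(l : intpart n) Pweight r l * \sum_(x <- parts l) 1 :> int.
  rewrite big_mkcond [X in _ - X]big_mkcond -sumrB; apply: eq_bigr => l _.
  rewrite !inE sizeE /Pweight -signr_odd.
  by case: (odd _); rewrite /= ?expr1 ?expr0; ring.
have -> : \sum_(l in Qo n r) (size l)%:R
        = \sum_(l : intpart n) Qweight r l * \sum_(x <- parts l) 1 :> int.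
  rewrite big_mkcond; apply: eq_bigr => l _.
  by rewrite inE sizeE /Qweight; case: (_ && _); rewrite ?mul1r ?mul0r.
rewrite (psum_weighted _ _ _ (Pweight_perm r) (Pweight_cons r)).
rewrite (psum_weighted _ _ _ (Qweight_perm r) (Qweight_cons r)).
rewrite card_Rpairs -sumrB [LHS]big_nat [RHS]big_nat.
apply: eq_bigr => N /andP[N_gt0 _]; rewrite psum_Pweight -mulrBr; congr (_ * _).
(* For c = 1 doubling turns the first correction sum into twice the number of divisors of N that are
   multiples of 2r; subtracting the second leaves that number once. *)
rewrite Pkernel_sum // (sum_divisors_double (fun=> 2 * 1)) //.
rewrite addrAC subrr add0r -sumrB; apply: eq_bigr => a _; ring.
Qed.
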